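(* Let $\mathbb{K}$ be an algebraically closed field of characteristic $0$, let $S=\mathbb{K}[z_1,\ldots,z_r,x_1,\ldots,x_s]$ be a polynomial ring and $A=\mathbb{K}[x_1,\ldots,x_s]$. Let $P\in S$ be a reduced form of degree $d\ge1$ such that $P\notin(x_1,\ldots,x_s)$. Then there exist at most $d^2(2d-1)$ reduced forms $Q_i\in A$ such that $Q_i,Q_j$ do not have common factors for $i\ne j$ and $(P,Q_i)$ is not radical for all $i$; that is, any family of reduced forms in $A$, pairwise without common factors, each of which generates together with $P$ a non-radical ideal of $S$, has at most $d^2(2d-1)$ members.
   Context: A form is a homogeneous polynomial for the standard grading; a form is reduced if it is square-free. Common factors mean non-unit common factors. *)

(* Defs.v *)
From HB Require Import structures.
From mathcomp Require Export all_boot all_order all_algebra.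
From mathcomp Require Export mpoly.

Set Implicit Arguments.
Unset Strict Implicit.
Unset Printing Implicit Defensive.

Import GRing.Theory.
Local Open Scope ring_scope.

Section CommutativeAlgebra.
Variable R : comUnitRingType.

Definition rdivides (a b : R) : Prop := exists c, b = c * a.

(* Zero is not square-free, units are: 0 is a non-unit whose square divides 0. *)
Definition squarefree (p : R) : Prop :=
  forall q, rdivides (q ^+ 2) p -> q \is a GRing.unit.

Definition no_common_factor (p q : R) : Prop :=
  forall g, rdivides g p -> rdivides g q -> g \is a GRing.unit.

Definition ideal_gen n (g : n.-tuple R) (f : R) : Prop :=
  exists c : 'I_n -> R, f = \sum_(i < n) c i * tnth g i.

(* The unit ideal counts as radical. *)
Definition radical_ideal (J : R -> Prop) : Prop :=
  forall f k, J (f ^+ k) -> J f.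

End CommutativeAlgebra.

Definition reduced_form (K : fieldType) n d (p : {mpoly K[n]}) : Prop :=
  p \is d.-homog /\ squarefree p.

(* In K[z_1..z_r, x_1..x_s] = {mpoly K[r + s]} the first r variables are the
   z_i and the last s variables are the x_j. *)
Definition xvars (K : fieldType) (r s : nat) : s.-tuple {mpoly K[r + s]} :=
  [tuple 'X_(rshift r j) | j < s].

(* The inclusion K[x_1..x_s] -> K[z_1..z_r, x_1..x_s]. *)
Definition inclA (K : fieldType) (r s : nat) (q : {mpoly K[s]}) :
  {mpoly K[r + s]} := q \mPo xvars K r s.

(* Main.v *)
From HB Require Import structures.
From Stdlib Require Import Classical ClassicalEpsilon.
From mathcomp Require Import perm generic_quotient ring_quotient mxpoly separable.
From mathcomp Require Import ring zify.
Require Import Defs.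
Local Open Scope ring_scope.

Set Implicit Arguments.
Unset Strict Implicit.
Unset Printing Implicit Defensive.

Import GRing.Theory Pdiv.Idomain.

(**
Since P is not in (x), some v in K^r x 0 has P(v) <> 0, so F(T) = P(y + T v)
is a polynomial in T over S whose leading coefficient P(v) is a unit; it is
square-free because P is, hence its discriminant D = Res_T(F, F') is a nonzero
element of S of degree at most d(2d-1). The translation fixes A, so (P, Q) is
radical as soon as (F, Q) is radical in S[T]. If no prime factor p of Q divides
D, then F stays separable over Frac(S/p), so f^k in (F, Q) forces F to divide f
modulo every such p, and therefore modulo their product Q. Thus each Q_i shares
a prime factor with D; these primes are pairwise non-associate, and their number
is at most deg D <= d^2(2d-1). That S is factorial is Gauss's lemma.
*)

(** * Factorial domains *)

Section Divisibility.
Variable R : comUnitRingType.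
Implicit Types a b c : R.

Lemma rdivides_refl a : rdivides a a.
Proof. by exists 1; rewrite mul1r. Qed.

Lemma rdivides_mull a b c : rdivides a b -> rdivides a (c * b).
Proof. by case=> d ->; exists (c * d); rewrite mulrA. Qed.

Lemma rdivides_mulr a b c : rdivides a b -> rdivides a (b * c).
Proof. by rewrite mulrC; apply: rdivides_mull. Qed.

Lemma rdivides_trans b a c : rdivides a b -> rdivides b c -> rdivides a c.
Proof. by move=> ab [d ->]; apply: rdivides_mull. Qed.

Lemma rdivides_add a b c : rdivides a b -> rdivides a c -> rdivides a (b + c).
Proof. by case=> d -> [e ->]; exists (d + e); rewrite mulrDl. Qed.

Lemma rdivides_unit a b : rdivides a b -> b \is a GRing.unit -> a \is a GRing.unit.
Proof. by case=> d ->; rewrite unitrM => /andP[]. Qed.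

End Divisibility.

Lemma rdivides_rmorph (R R' : comUnitRingType) (f : {rmorphism R -> R'}) a b :
  rdivides a b -> rdivides (f a) (f b).
Proof. by case=> c ->; exists (f c); rewrite rmorphM. Qed.

Section Primes.
Variable R : idomainType.
Implicit Types (a b c p q : R) (s : seq R).

Definition prime_elt p : Prop :=
  [/\ p != 0, p \isn't a GRing.unit
    & forall a b, rdivides p (a * b) -> rdivides p a \/ rdivides p b].

(** Only existence of a factorization is required: its factors are prime, not merely irreducible, so
    uniqueness up to units is automatic. *)
Definition factorial_domain : Prop :=
  forall a, a != 0 -> exists u s,
    [/\ u \is a GRing.unit, forall p, p \in s -> prime_elt p
      & a = u * \prod_(p <- s) p].

Lemma prime_ndvd_unit p u : prime_elt p -> u \is a GRing.unit -> ~ rdivides p u.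
Proof. by case=> _ /negP np _ uu /rdivides_unit/(_ uu). Qed.

Lemma prime_dvd_prod p s :
  prime_elt p -> rdivides p (\prod_(x <- s) x) ->
  exists2 q, q \in s & rdivides p q.
Proof.
move=> pp; elim: s => [|x s IHs].
  by rewrite big_nil => /(prime_ndvd_unit pp (unitr1 R)).
rewrite big_cons; have [_ _ pM] := pp => /pM[px|/IHs[q qs pq]].
  by exists x; rewrite ?mem_head.
by exists q; rewrite // in_cons qs orbT.
Qed.

(** Write q = c p. As q is prime it divides c or p; the first would make p a unit, the second makes
    c one. *)
Lemma prime_dvd_prime p q :
  prime_elt p -> prime_elt q -> rdivides p q ->
  exists2 u, u \is a GRing.unit & q = u * p.
Proof.
move=> [p0 pU _] [q0 qU qM] [c qE]; exists c => //.
have: rdivides q (c * p) by rewrite -qE; apply: rdivides_refl.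
case/qM => -[d dE].
  suff: p \is a GRing.unit by rewrite (negPf pU).
  have c0 : c != 0 by apply: contraNneq q0 => c0; rewrite qE c0 mul0r.
  apply/unitrPr; exists d; apply: (mulfI c0).
  by rewrite mulr1 [RHS]dE qE; ring.
apply/unitrPr; exists d; apply: (mulIf p0).
by rewrite mul1r [RHS]dE qE; ring.
Qed.

Lemma prime_dvd_rem p s :
  prime_elt p -> (forall q, q \in s -> prime_elt q) ->
  rdivides p (\prod_(x <- s) x) ->
  exists u s', [/\ u \is a GRing.unit, forall q, q \in s' -> prime_elt q,
    size s = (size s').+1 & \prod_(x <- s) x = u * p * \prod_(x <- s') x].
Proof.
move=> pp sp ps; have [q qs pq] := prime_dvd_prod pp ps.
have [u uu qE] := prime_dvd_prime pp (sp _ qs) pq.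
exists u, (rem q s); split=> //.
- by move=> x /mem_rem; apply: sp.
- by rewrite size_rem // prednK //; case: (s) qs.
- by rewrite (perm_big _ (perm_to_rem qs)) big_cons -qE.
Qed.

(** Induction on the list: after dividing b by the first prime p, the other primes still divide the
    quotient, since none of them divides p. *)
Lemma squarefree_prod_dvd s b :
  (forall p, p \in s -> prime_elt p) -> squarefree (\prod_(p <- s) p) ->
  (forall p, p \in s -> rdivides p b) -> rdivides (\prod_(p <- s) p) b.
Proof.
elim: s b => [|p s IHs] b sp sq sb; first by rewrite big_nil; exists b; rewrite mulr1.
have [p0 pU pM] := sp p (mem_head _ _).
have [|d dE] := sb p; first by rewrite mem_head.
rewrite big_cons; suff [e eE] : rdivides (\prod_(q <- s) q) d.
  by exists e; rewrite dE eE -mulrA (mulrC p).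
apply: IHs.
- by move=> q qs; apply: sp; rewrite in_cons qs orbT.
- by move=> q qq; apply: sq; rewrite big_cons; apply: rdivides_mull.
move=> q qs; have qp : prime_elt q by apply: sp; rewrite in_cons qs orbT.
have [_ _ qM] := qp.
have : rdivides q (d * p) by rewrite -dE; apply: sb; rewrite in_cons qs orbT.
case/qM => // -[c cE].
(* If q divided p, the two would be associate and the product would contain the square of p. *)
case/negP: (pU); apply: sq; rewrite big_cons (perm_big _ (perm_to_rem qs)) big_cons.
have [|u uu pE] := prime_dvd_prime qp (sp p (mem_head _ _)); first by exists c.
exists (u^-1 * \prod_(x <- rem q s) x); rewrite pE /=.
by rewrite -[LHS]mul1r -(mulVr uu); ring.
Qed.

End Primes.

(** * The residue domain modulo a prime element *)

Section PrimeQuotient.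
Variables (R : idomainType) (p : R) (p_prime : prime_elt p).

(** The ideal quotient expects a boolean predicate, so divisibility is decided classically. *)
Definition principal : pred R :=
  fun a => if excluded_middle_informative (rdivides p a) then true else false.

Lemma principalP a : reflect (rdivides p a) (a \in principal).
Proof.
by rewrite unfold_in /principal; case: excluded_middle_informative => h; constructor.
Qed.

Lemma principal_idealr_closed : idealr_closed principal.
Proof.
have [p0 pU _] := p_prime; split.
- by apply/principalP; exists 0; rewrite mul0r.
- by apply/principalP; apply: (prime_ndvd_unit p_prime); apply: unitr1.
move=> a x y /principalP px /principalP py; apply/principalP.
by apply: rdivides_add => //; apply: rdivides_mull.
Qed.

Lemma principal_prime : prime_idealr_closed principal.
Proof.
have [_ _ pM] := p_prime => u v /principalP/pM[] /principalP -> //.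
by rewrite orbT.
Qed.

HB.instance Definition _ := isIdealr.Build R principal principal_idealr_closed.
HB.instance Definition _ := isPrimeIdealrClosed.Build R principal principal_prime.

Definition principal_prime_idealr : prime_idealr R := PrimeIdealr.clone R principal _.
Definition prime_quot : Type := {ideal_quot principal_prime_idealr}.
HB.instance Definition _ := GRing.ComNzRing.on prime_quot.
Local Notation L := prime_quot.

(** Invertibility in the quotient is also decided classically; [invL] chooses an inverse and returns
    x itself when there is none. *)
Let unitL (x : L) : bool :=
  if excluded_middle_informative (exists y, y * x = 1) then true else false.

Let invL (x : L) : L :=
  match excluded_middle_informative (exists y, y * x = 1) with
  | left h => projT1 (constructive_indefinite_description _ h)
  | right _ => x
  end.

Let mulVL : {in unitL, left_inverse 1 invL *%R}.
Proof.
move=> x; rewrite unfold_in /unitL /invL; case: excluded_middle_informative => // h _.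
by case: constructive_indefinite_description.
Qed.

Let unitLP x y : y * x = 1 -> x \in unitL.
Proof.
move=> yx; rewrite unfold_in /unitL; case: excluded_middle_informative => // -[].
by exists y.
Qed.

Let invL_out : {in [predC unitL], invL =1 id}.
Proof.
by move=> x; rewrite inE /= unfold_in /unitL /invL; case: excluded_middle_informative.
Qed.

HB.instance Definition _ := GRing.ComNzRing_hasMulInverse.Build L mulVL unitLP invL_out.
HB.instance Definition _ :=
  GRing.ComUnitRing_isIntegral.Build L (@Quotient.rquot_IdomainAxiom R principal_prime_idealr).

Lemma prime_quotient :
  exists (D : idomainType) (f : {rmorphism R -> D}), forall a, f a = 0 <-> rdivides p a.
Proof.
pose pi : {rmorphism R -> {ideal_quot principal_prime_idealr}} :=
  \pi_({ideal_quot principal_prime_idealr})%qT.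
exists L, pi => a.
have -> : pi a = 0 <-> a \in principal.
  rewrite -[0](rmorph0 pi) -[a in X in _ <-> X]subr0 Quotient.idealrBE.
  by split=> /eqP.
by split=> /principalP.
Qed.

End PrimeQuotient.

(** * Gauss's lemma: polynomials over a factorial domain *)

Section Gauss.
Variable R : idomainType.
Implicit Types (a b c p q : R) (f g h : {poly R}).

Lemma rdivides_polyC c f : rdivides c%:P f <-> forall i, rdivides c f`_i.
Proof.
split=> [[g ->] i|cf]; first by rewrite coefMC; exists g`_i.
have [g gE] := choice (fun i d => f`_i = d * c) cf.
exists (\poly_(i < size f) g i); apply/polyP=> i; rewrite coefMC coef_poly.
by case: ltnP => [_|/(nth_default 0) ->]; rewrite ?gE // mul0r.
Qed.

(** The multiples of p in R[T] are the kernel of coefficientwise reduction into polynomials over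
    R/p, which form a domain. *)
Lemma prime_polyC p : prime_elt p -> prime_elt p%:P.
Proof.
move=> pp; have [p0 pU _] := pp.
have [D [phi phiE]] := prime_quotient pp.
have phiP f : map_poly phi f = 0 <-> rdivides p%:P f.
  rewrite rdivides_polyC; split=> [f0 i|pf].
    by apply/phiE; rewrite -coef_map f0 coef0.
  by apply/polyP=> i; rewrite coef_map coef0; apply/phiE.
split; first by rewrite polyC_eq0.
  by rewrite poly_unitE coefC eqxx (negPf pU) andbF.
move=> f g /phiP; rewrite rmorphM => /eqP; rewrite mulf_eq0.
by case/orP=> /eqP/phiP; [left|right].
Qed.

Hypothesis R_factorial : factorial_domain R.

Definition primitive_poly f : Prop := forall p, prime_elt p -> ~ rdivides p%:P f.

Lemma content f : f != 0 ->
  exists c g, [/\ c != 0, primitive_poly g & f = c%:P * g].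
Proof.
(* The length of [s] is the induction measure: each prime divided out of f divides the leading
   coefficient, hence can be struck from the list. *)
move=> f0; have [s sp lf] : exists2 s, forall p, p \in s -> prime_elt p
    & rdivides (lead_coef f) (\prod_(x <- s) x).
  have lf0 : lead_coef f != 0 by rewrite lead_coef_eq0.
  have [u [s [uu sp lE]]] := R_factorial lf0.
  by exists s => //; exists u^-1; rewrite lE mulKr.
have [n sn] := ubnP (size s).
elim: n => // n IHn in s sn f f0 sp lf *.
have [prim|] := classic (primitive_poly f).
  by exists 1, f; rewrite mul1r oner_eq0.
move=> nprim; have [p np] := not_all_ex_not _ _ nprim.
have [pp npf] := imply_to_and _ _ np; have [g fE] := NNPP _ npf.
have [p0 _ _] := pp.
have [g0 lfE] : g != 0 /\ lead_coef f = lead_coef g * p.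
  split; last by rewrite fE lead_coefM lead_coefC.
  by apply: contraNneq f0 => g0; rewrite fE g0 mul0r.
have ps : rdivides p (\prod_(x <- s) x).
  by apply: rdivides_trans lf; exists (lead_coef g).
have [u [s' [uu s'p sE prE]]] := prime_dvd_rem pp sp ps.
have lg : rdivides (lead_coef g) (\prod_(x <- s') x).
  have [d dE] := lf; exists (u^-1 * d); apply: (mulIf p0).
  apply: (mulfI (_ : u != 0)); first by apply: contraTneq uu => ->; rewrite unitr0.
  transitivity (\prod_(x <- s) x); first by rewrite prE; ring.
  rewrite dE lfE -[LHS]mul1r -(mulrV uu); ring.
have s'n : (size s' < n)%N by rewrite -ltnS -sE.
have [c [h [c0 hp gE]]] := IHn s' s'n g g0 s'p lg.
exists (p * c), h; split=> //; first by rewrite mulf_neq0.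
by rewrite fE gE polyCM; ring.
Qed.

(** The primes of c are removed one at a time: each divides the cofactor times f, but not f, hence
    divides the cofactor. *)
Lemma primitive_dvd_cancel f g c : primitive_poly f -> c != 0 ->
  rdivides f (c%:P * g) -> rdivides f g.
Proof.
move=> fp c0; have [u [s [uu sp ->]]] := R_factorial c0.
have uuP : u%:P \is a GRing.unit by rewrite rmorph_unit.
rewrite polyCM -mulrA => -[h /(canRL (mulKr uuP)) hE].
have {h hE} : rdivides f ((\prod_(p <- s) p)%:P * g).
  by rewrite hE mulrA; apply: rdivides_mull; apply: rdivides_refl.
elim: s sp g => [|p s IHs] sp g; first by rewrite big_nil mul1r.
rewrite big_cons polyCM -mulrA => -[h hE].
have pp := prime_polyC (sp p (mem_head _ _)); have [p0 _ pM] := pp.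
apply: IHs; first by move=> q qs; apply: sp; rewrite in_cons qs orbT.
have : rdivides p%:P (h * f) by rewrite -hE; apply: rdivides_mulr; apply: rdivides_refl.
case/pM => [[k kE]|/(fp _ (sp p (mem_head _ _))) //].
by exists k; apply: (mulfI p0); rewrite hE kE; ring.
Qed.

(** Brings a factorization over the fraction field back to R. Each prime of c stays prime in R[T],
    so it divides g or h and can be cancelled there. *)
Lemma factor_cancel c f g h : c != 0 -> c%:P * f = g * h ->
  exists c1 c2 g' h', [/\ f = g' * h', c1 * c2 = c, g = c1%:P * g' & h = c2%:P * h'].
Proof.
move=> c0; have [u [s [uu sp ->]]] := R_factorial c0.
elim: s sp g h {c c0} => [|p s IHs] sp g h.
  rewrite big_nil mulr1 => ghE.
  exists u, 1, (u^-1%:P * g), h; rewrite mulr1 mul1r !mulrA -!polyCM mulrV // mul1r.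
  by split=> //; rewrite -mulrA -ghE mulrA -polyCM mulVr // mul1r.
rewrite big_cons => ghE.
have pp := prime_polyC (sp p (mem_head _ _)); have [p0 _ pM] := pp.
have sp' q : q \in s -> prime_elt q by move=> qs; apply: sp; rewrite in_cons qs orbT.
have : rdivides p%:P (g * h).
  by rewrite -ghE; exists ((u * \prod_(j <- s) j)%:P * f); rewrite !polyCM; ring.
case/pM => -[k kE].
  have [|c1 [c2 [g' [h' [fE cE gE hE]]]]] := IHs sp' k h.
    apply: (mulfI p0); rewrite [RHS]mulrA [_ * k]mulrC -kE -ghE !polyCM; ring.
  exists (p * c1), c2, g', h'; split=> //; first by rewrite -mulrA cE; ring.
  by rewrite kE gE polyCM; ring.
have [|c1 [c2 [g' [h' [fE cE gE hE]]]]] := IHs sp' g k.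
  apply: (mulfI p0); rewrite [RHS]mulrCA [_ * k]mulrC -kE -ghE !polyCM; ring.
exists c1, (p * c2), g', h'; split=> //; first by rewrite mulrCA cE; ring.
by rewrite kE hE polyCM; ring.
Qed.

Lemma size_polyCM c f : c != 0 -> size (c%:P * f) = size f.
Proof. by move=> c0; rewrite mul_polyC size_scale. Qed.

(** Over the fraction field f either divides g or is coprime to it; coprimality lets f be cancelled
    from a product, and primitivity turns divisibility up to constants into divisibility in R[T]. *)
Lemma primitive_irreducible_prime f : primitive_poly f -> (1 < size f)%N ->
  (forall g h, f = g * h -> (1 < size g)%N -> (1 < size h)%N -> False) ->
  prime_elt f.
Proof.
move=> fp fs firr; have f0 : f != 0 by rewrite -size_poly_gt0 ltnW.
split=> //; first by rewrite poly_unitE eqn_leq leqNgt fs.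
(* Pseudo-division scales g by a power of the leading coefficient of f, which is then cancelled
   because f is primitive. *)
have pseudo g : f %| g -> rdivides f g.
  rewrite dvdp_eq => /eqP gE.
  apply: (@primitive_dvd_cancel f g (lead_coef f ^+ scalp g f)) => //.
    by rewrite expf_neq0 // lead_coef_eq0.
  by rewrite mul_polyC gE; exists (g %/ f).
have cop g : f %| g \/ coprimep f g.
  have := dvdp_gcdl f g; set G := gcdp f g; rewrite dvdp_eq => /eqP fE.
  set c := _ ^+ _ in fE; have G0 : G != 0 by rewrite gcdp_eq0 negb_and f0.
  have c0 : c != 0 by rewrite expf_neq0 // lead_coef_eq0.
  rewrite -mul_polyC in fE.
  (* Here h' is proportional to the gcd. If it is not constant, irreducibility makes g' constant, so
     f itself is proportional to the gcd. *)
  have [c1 [c2 [g' [h' [fE' cE gE hE]]]]] := factor_cancel c0 fE.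
  have [c10 c20] : c1 != 0 /\ c2 != 0.
    by move: c0; rewrite -cE mulf_eq0 => /norP.
  have [hs|hs] := ltnP 1 (size h').
    have [gs|gs] := ltnP 1 (size g').
      by case: (firr _ _ fE').
    left; apply: (dvdp_trans _ (dvdp_gcdr f g)); rewrite -/G hE fE'.
    have g'0 : g' != 0 by apply: contraNneq f0 => g'0; rewrite fE' g'0 mul0r.
    have /size_poly1P[e e0 ->] : size g' == 1 by rewrite eqn_leq gs size_poly_gt0.
    by rewrite !mul_polyC dvdpZr // dvdpZl.
  right; rewrite coprimep_def -/G hE size_polyCM // eqn_leq hs size_poly_gt0.
  by apply: contraNneq f0 => h'0; rewrite fE' h'0 mulr0.
move=> g h [k kE]; have fgh : f %| g * h by rewrite kE dvdp_mull.
case: (cop g) => [/pseudo|fg]; first by left.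
by right; apply: pseudo; rewrite Gauss_dvdpr in fgh.
Qed.

(** Induction on the degree: split f into two non-constant factors if possible; otherwise its
    primitive part is prime, and the content factors in R. *)
Lemma factorial_poly : factorial_domain {poly R}.
Proof.
have const c : c != 0 -> exists (u : {poly R}) s, [/\ u \is a GRing.unit,
    forall p : {poly R}, p \in s -> prime_elt p & c%:P = u * \prod_(p <- s) p].
  move=> /R_factorial[u [s [uu sp cE]]].
  exists u%:P, (map polyC s); split.
  - by rewrite rmorph_unit.
  - by move=> p /mapP[q qs ->]; apply/prime_polyC/sp.
  - by rewrite big_map -rmorph_prod -polyCM -cE.
move=> f; elim: {f}(size f) {-2}f (leqnn (size f)) => [|n IHn] f.
  by rewrite leqn0 size_poly_eq0 => ->.
move=> fn f0; have [fs|fs] := leqP (size f) 1.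
  by rewrite (size1_polyC fs); apply: const; rewrite -polyC_eq0 -(size1_polyC fs).
have [[g [h [fE gs hs]]]|irr] := classic
    (exists g h, [/\ f = g * h, (1 < size g)%N & (1 < size h)%N]).
  have [g0 h0] : g != 0 /\ h != 0 by move: f0; rewrite fE mulf_eq0 => /norP.
  have sE : (size f).+1 = (size g + size h)%N.
    by rewrite fE size_mul // prednK // addn_gt0 size_poly_gt0 g0.
  have gn : (size g <= n)%N.
    by rewrite -ltnS (leq_trans _ fn) // -ltnS sE -[X in (X < _)%N]addn1 ltn_add2l.
  have hn : (size h <= n)%N.
    by rewrite -ltnS (leq_trans _ fn) // -ltnS sE -[X in (X < _)%N]add1n ltn_add2r.
  have [u [s [uu sp gE]]] := IHn g gn g0.
  have [u' [s' [uu' sp' hE]]] := IHn h hn h0.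
  exists (u * u'), (s ++ s'); split; first by rewrite unitrM uu.
    by move=> p; rewrite mem_cat => /orP[/sp|/sp'].
  by rewrite fE big_cat /= gE hE; ring.
have [c [g [c0 gp fE]]] := content f0.
have [u [s [uu sp cE]]] := const c c0.
have sg : size g = size f by rewrite fE size_polyCM.
exists u, (g :: s); split=> //.
  move=> p; rewrite in_cons => /predU1P[->|/sp //].
  apply: primitive_irreducible_prime => //; first by rewrite sg.
  move=> a b gE sa sb; apply: irr; exists (c%:P * a), b.
  by rewrite size_polyCM // -mulrA -gE.
by rewrite big_cons fE cE; ring.
Qed.

End Gauss.

(** * Multivariate polynomials *)

Lemma mpoly_rmorph_ext n (R : comNzRingType) (S : nzRingType)
    (f g : {rmorphism {mpoly R[n]} -> S}) :
  (forall c, f c%:MP = g c%:MP) -> (forall i, f 'X_i = g 'X_i) -> f =1 g.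
Proof.
move=> fgC fgX p; rewrite [p]mpolyE !rmorph_sum; apply: eq_bigr => m _ /=.
rewrite -mul_mpolyC !rmorphM fgC mpolyXE_id !rmorph_prod /=; congr (_ * _).
by apply: eq_bigr => i _; rewrite !rmorphXn fgX.
Qed.

Lemma poly_rmorph_ext (R S : nzRingType) (f g : {rmorphism {poly R} -> S}) :
  (forall c, f c%:P = g c%:P) -> f 'X = g 'X -> f =1 g.
Proof.
move=> fgC fgX p; rewrite -[p]coefK poly_def !rmorph_sum; apply: eq_bigr => i _ /=.
by rewrite -mul_polyC !rmorphM !rmorphXn fgC fgX.
Qed.

Lemma factorial_transfer (R R' : idomainType) (f : {rmorphism R -> R'})
    (g : {rmorphism R' -> R}) :
  cancel f g -> cancel g f -> factorial_domain R' -> factorial_domain R.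
Proof.
move=> fK gK R'f a a0; have fa0 : f a != 0 by rewrite -(rmorph0 f) (inj_eq (can_inj fK)).
have [u [s [uu sp faE]]] := R'f _ fa0.
exists (g u), (map g s); split; first by rewrite rmorph_unit.
  move=> _ /mapP[p /sp[p0 pU pM] ->]; split.
  - by rewrite -(inj_eq (can_inj gK)) rmorph0 in p0.
  - by apply: contraNN pU => /(rmorph_unit f); rewrite gK.
  move=> x y /(rdivides_rmorph f); rewrite gK rmorphM => /pM[h|h]; [left|right];
    by have := rdivides_rmorph g h; rewrite fK.
by rewrite big_map -rmorph_prod -rmorphM -faE fK.
Qed.

Section FirstVariable.
Variables (R : comNzRingType) (n : nat).

(** With its inverse [join_first], the isomorphism that allows induction on the number of
    variables. *)
Definition split_first : {mpoly R[n.+1]} -> {poly {mpoly R[n]}} :=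
  mmap (polyC \o @mpolyC n R)
    (fun i => if unlift ord0 i is Some j then ('X_j)%:P else 'X).
HB.instance Definition _ := GRing.RMorphism.on split_first.

Definition join_first : {poly {mpoly R[n]}} -> {mpoly R[n.+1]} :=
  horner_eval 'X_ord0 \o
  map_poly (mmap (@mpolyC n.+1 R) (fun j => 'X_(lift ord0 j))).
HB.instance Definition _ := GRing.RMorphism.on join_first.

Lemma split_firstC c : split_first c%:MP = c%:MP%:P.
Proof. by rewrite [LHS]mmapC. Qed.

Lemma split_first0 : split_first 'X_ord0 = 'X.
Proof. by rewrite [LHS]mmapX mmap1U unlift_none. Qed.

Lemma split_first_lift j : split_first 'X_(lift ord0 j) = ('X_j)%:P.
Proof. by rewrite [LHS]mmapX mmap1U liftK. Qed.

Lemma join_firstCC c : join_first c%:MP%:P = c%:MP.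
Proof. by rewrite /join_first /= map_polyC /= horner_evalE hornerC mmapC. Qed.

Lemma join_firstCX j : join_first ('X_j)%:P = 'X_(lift ord0 j).
Proof.
by rewrite /join_first /= map_polyC /= horner_evalE hornerC mmapX mmap1U.
Qed.

Lemma join_firstX : join_first 'X = 'X_ord0.
Proof. by rewrite /join_first /= map_polyX horner_evalE hornerX. Qed.

Lemma split_firstK : cancel split_first join_first.
Proof.
apply: (@mpoly_rmorph_ext _ _ _ (join_first \o split_first) idfun) => [c|i] /=.
  by rewrite split_firstC join_firstCC.
case: (unliftP ord0 i) => [j|] ->; first by rewrite split_first_lift join_firstCX.
by rewrite split_first0 join_firstX.
Qed.

Lemma join_firstK : cancel join_first split_first.
Proof.
apply: (@poly_rmorph_ext _ _ (split_first \o join_first) idfun) => [c|] /=;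
  last by rewrite join_firstX split_first0.
apply: (@mpoly_rmorph_ext _ _ _ (split_first \o join_first \o polyC) polyC) => [a|j] /=.
  by rewrite join_firstCC split_firstC.
by rewrite join_firstCX split_first_lift.
Qed.

Lemma meval_split_first (v : 'I_n.+1 -> R) p :
  p.@[v] = (map_poly (meval (v \o lift ord0)) (split_first p)).[v ord0].
Proof.
pose ev := horner_eval (v ord0) \o map_poly (meval (v \o lift ord0)) \o split_first.
apply: (@mpoly_rmorph_ext _ _ _ (meval v) ev) => [c|i]; rewrite /ev /=.
  by rewrite mevalC split_firstC map_polyC horner_evalE hornerC /= mevalC.
rewrite mevalXU; case: (unliftP ord0 i) => [j|] ->.
  by rewrite split_first_lift map_polyC horner_evalE hornerC /= mevalXU.
by rewrite split_first0 map_polyX horner_evalE hornerX.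
Qed.

End FirstVariable.

Lemma factorial_mpoly (K : fieldType) n : factorial_domain {mpoly K[n]}.
Proof.
elim: n => [|n IHn].
  move=> p p0; exists p, [::]; rewrite big_nil mulr1; split=> //.
  by rewrite [p]nvar0_mpolyC rmorph_unit // unitfE -(mpolyC_eq0 0) -nvar0_mpolyC.
exact: (factorial_transfer (@split_firstK K n) (@join_firstK K n) (factorial_poly IHn)).
Qed.

(** By induction the leading coefficient in the first variable is nonzero at some w; specializing at
    w leaves a nonzero univariate polynomial, which has a non-root. *)
Lemma mpoly_nonroot (K : closedFieldType) n (p : {mpoly K[n]}) :
  p != 0 -> exists v, p.@[v] != 0.
Proof.
elim: n p => [|n IHn] p p0.
  exists (fun _ => 0).
  by rewrite [p]nvar0_mpolyC mevalC -(mpolyC_eq0 0) -nvar0_mpolyC.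
have /IHn[w w0] : lead_coef (split_first p) != 0.
  by rewrite lead_coef_eq0 -(inj_eq (can_inj (@join_firstK K n))) split_firstK rmorph0.
have /closed_nonrootP[x] : map_poly (meval w) (split_first p) != 0.
  apply: contraNneq w0 => /polyP/(_ (size (split_first p)).-1).
  by rewrite coef_map coef0 /= => /eqP.
rewrite rootE => xP; exists (fun i => if unlift ord0 i is Some j then w j else x).
rewrite meval_split_first unlift_none.
rewrite (_ : map_poly _ _ = map_poly (meval w) (split_first p)) //.
apply: eq_map_poly => q; apply: meval_eq => j /=; by rewrite liftK.
Qed.

(** * Discriminants and radicality *)

Lemma squarefree_neq0 (R : idomainType) (p : R) : squarefree p -> p != 0.
Proof.
move=> sq; apply/eqP => p0; have : (0 : R) \is a GRing.unit.
  by apply: sq; exists 0; rewrite mul0r.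
by rewrite unitr0.
Qed.

(** The leading coefficients must survive so that the Sylvester matrix keeps its size. *)
Lemma rmorph_resultant (R R' : nzRingType) (f : {rmorphism R -> R'}) (p q : {poly R}) :
  f (lead_coef p) != 0 -> f (lead_coef q) != 0 ->
  f (resultant p q) = resultant (map_poly f p) (map_poly f q).
Proof.
move=> p0 q0; rewrite /resultant /Sylvester_mx !size_map_poly_id0 //.
rewrite -det_map_mx /= map_col_mx; congr (\det (col_mx _ _));
  by apply: map_lin1_mx => v; rewrite map_poly_rV rmorphM /= map_rVpoly.
Qed.

Section Char0Derivative.
Variables (R : idomainType) (char0 : forall n, n.+1%:R != 0 :> R).
Implicit Types p : {poly R}.

Lemma size_deriv_char0 p : size p^`() = (size p).-1.
Proof.
have [|sp] := leqP (size p) 1.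
  by move=> sp; rewrite (size1_polyC sp) derivC size_poly0 size_polyC; case: eqP.
have p0 : p != 0 by rewrite -size_poly_gt0 ltnW.
apply/eqP; rewrite eqn_leq -ltnS (leq_trans (lt_size_deriv p0)) ?leqSpred //=.
have -> : (size p).-1 = (size p).-2.+1 by case: (size p) sp => [|[]].
rewrite ltnNge; apply/negP => /leq_sizeP/(_ _ (leqnn _))/eqP.
rewrite coef_deriv -mulr_natr mulf_eq0 (negPf (char0 _)) orbF.
rewrite (_ : (size p).-2.+1 = (size p).-1); last by case: (size p) sp => [|[]].
by rewrite -/(lead_coef p) lead_coef_eq0 (negPf p0).
Qed.

Lemma lead_coef_deriv_char0 p : lead_coef p^`() = lead_coef p *+ (size p).-1.
Proof.
rewrite lead_coefE size_deriv_char0 coef_deriv; case sE: (size p) => [|[|n]] /=.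
- by rewrite !nth_default ?sE // mul0rn.
- by rewrite nth_default ?sE // mul0rn.
- by rewrite lead_coefE sE.
Qed.

End Char0Derivative.

(** Let g be the gcd of F and f, and h = F/g. Separability makes h coprime to g, and h is coprime to
    f/g, hence to f; but h divides a power of f, so h is constant. *)
Lemma separable_dvd_exp (R : idomainType) (F f : {poly R}) k :
  separable_poly F -> F %| f ^+ k -> F %| f.
Proof.
move=> Fsep Ff; have F0 := separable_poly_neq0 Fsep.
set g := gcdp F f; have g0 : g != 0 by rewrite gcdp_eq0 negb_and F0.
have := dvdp_gcdl F f; rewrite dvdp_eq -/g => /eqP; set c := _ ^+ _ => FE.
have := dvdp_gcdr F f; rewrite dvdp_eq -/g => /eqP; set c' := _ ^+ _ => fE.
have c0 : c != 0 by rewrite expf_neq0 // lead_coef_eq0.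
have c'0 : c' != 0 by rewrite expf_neq0 // lead_coef_eq0.
set h := F %/ g in FE.
have hF : h * g %| F by rewrite -FE dvdpZl.
have hg : coprimep h g := separable_coprime Fsep hF.
have hf : coprimep h f.
  by rewrite -(coprimepZr _ _ c'0) fE coprimepMr hg coprimep_div_gcd ?F0.
have h_f : h %| f ^+ k by apply: dvdp_trans Ff; apply: dvdp_trans hF; apply: dvdp_mulIl.
have : coprimep h h := coprimep_dvdl h_f (coprimep_expr k hf).
rewrite coprimepp => /size_poly1P[e e0 hE].
by rewrite -(dvdpZl _ _ c0) FE hE mul_polyC dvdpZl // dvdp_gcdr.
Qed.

Section Discriminant.
Variables (R : idomainType) (R_factorial : factorial_domain R).
Implicit Types F f : {poly R}.

Lemma unit_lead_primitive F : lead_coef F \is a GRing.unit -> primitive_poly F.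
Proof.
move=> lu p pp [g gE]; apply: (prime_ndvd_unit pp lu).
by exists (lead_coef g); rewrite gE lead_coefM lead_coefC.
Qed.

(** A square factor over the fraction field descends to a square factor over R, because the factors
    of F have unit leading coefficients and are therefore primitive. *)
Lemma squarefree_separable F : (forall n, n.+1%:R != 0 :> R) ->
  lead_coef F \is a GRing.unit -> squarefree F -> separable_poly F.
Proof.
move=> char0 lu sq.
have F0 : F != 0 by apply: contraTneq lu => ->; rewrite lead_coef0 unitr0.
(* Separability means having no square factor and no non-constant factor with zero derivative;
   characteristic 0 rules out the latter. *)
apply/separable_polyP; split; last first.
  move=> u _ us; rewrite -size_poly_eq0 size_deriv_char0 //.
  by case: (size u) us => [|[]].
apply/poly_square_freeP => u us; apply/negP => u2F.
have u0 : u != 0.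
  by apply: contraTneq u2F => ->; rewrite expr0n /= dvd0p.
move: u2F; rewrite dvdp_eq => /eqP; set c := _ ^+ _; set k := _ %/ _ => FE.
have c0 : c != 0 by rewrite expf_neq0 // lead_coef_eq0 expf_neq0.
have {FE}FE : c%:P * F = u * (k * u) by rewrite mul_polyC FE; ring.
have [c1 [c2 [g [h [FE' cE uE kuE]]]]] := factor_cancel R_factorial c0 FE.
have lg : lead_coef g \is a GRing.unit.
  by move: lu; rewrite FE' lead_coefM unitrM => /andP[].
have [c10 c20] : c1 != 0 /\ c2 != 0 by move: c0; rewrite -cE mulf_eq0 => /norP.
have [m mE] : rdivides g h.
  apply: (primitive_dvd_cancel R_factorial (unit_lead_primitive lg) c20).
  by exists (k * c1%:P); rewrite -kuE uE; ring.
have : g \is a GRing.unit by apply: sq; exists m; rewrite FE' mE; ring.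
by rewrite poly_unitE => /andP[gs _]; case/negP: us; rewrite uE size_polyCM.
Qed.

Lemma radical_of_discriminant F (Q : R) :
  lead_coef F \is a GRing.unit -> lead_coef F^`() \is a GRing.unit ->
  squarefree Q ->
  (forall p, prime_elt p -> rdivides p Q -> ~ rdivides p (resultant F F^`())) ->
  forall f k a b, f ^+ k = a * F + b * Q%:P -> exists a' b', f = a' * F + b' * Q%:P.
Proof.
move=> lF lF' sqQ cop f k a b fkE.
have Q0 := squarefree_neq0 sqQ.
have [u [s [uu sp QE]]] := R_factorial Q0.
(* The unit leading coefficient makes this an exact Euclidean division over R, so it remains to show
   that Q divides every coefficient of the remainder. *)
pose r := f %% F; have fE : f = f %/ F * F + r := Pdiv.IdomainUnit.divp_eq lF f.
suff /rdivides_polyC Qr : forall i, rdivides Q r`_i.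
  by have [b' bE] := Qr; exists (f %/ F), b'; rewrite -bE.
have F0 : F != 0 by apply: contraTneq lF => ->; rewrite lead_coef0 unitr0.
have pr p : p \in s -> rdivides p%:P r.
  move=> ps; have pp := sp p ps; have [D [phi phiE]] := prime_quotient pp.
  have phiU x : x \is a GRing.unit -> phi x != 0.
    by move=> ux; apply/eqP => /phiE/(prime_ndvd_unit pp ux).
  have pQ : rdivides p Q.
    rewrite QE (perm_big _ (perm_to_rem ps)) big_cons.
    by exists (u * \prod_(x <- rem p s) x); rewrite /=; ring.
  (* Both leading coefficients are units, so the discriminant of F reduces to that of F modulo p,
     which is nonzero. *)
  have sF : separable_poly (map_poly phi F).
    rewrite separable_poly.unlock /coprimep deriv_map.
    rewrite eqn_leq leqNgt -resultant_eq0 -(rmorph_resultant (phiU _ lF) (phiU _ lF')).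
    rewrite size_poly_gt0 gcdp_eq0 negb_and map_poly_eq0_id0; last exact: phiU.
    rewrite F0 andbT.
    by apply/negP => /eqP/phiE; apply: cop.
  have FE : map_poly phi F %| map_poly phi f.
    apply: (separable_dvd_exp sF (k := k)).
    have phiQ : phi Q = 0 by apply/phiE.
    rewrite -rmorphXn fkE rmorphD !rmorphM /= map_polyC /= phiQ mulr0 addr0.
    exact: dvdp_mull.
  (* Modulo p, F divides r yet keeps its full degree, which exceeds that of r. *)
  have r0 : map_poly phi r = 0.
    apply/eqP; apply: contraTT FE => r0.
    rewrite fE rmorphD rmorphM dvdp_addr ?dvdp_mull //.
    rewrite gtNdvdp // size_map_poly_id0 ?phiU //.
    by rewrite (leq_ltn_trans (size_poly _ _)) // ltn_modpN0.
  apply/rdivides_polyC => i; apply/phiE; by rewrite -coef_map r0 coef0.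
move=> i.
suff [c cE] : rdivides (\prod_(p <- s) p) r`_i.
  by exists (u^-1 * c); rewrite cE QE mulrACA mulVr // mul1r.
apply: squarefree_prod_dvd => //.
  by move=> x xs; apply: sqQ; rewrite QE; apply: rdivides_mull.
by move=> p ps; have /rdivides_polyC := pr p ps; apply.
Qed.

End Discriminant.

(** * Translation along a vector *)

Lemma dvd_polyC (R : idomainType) (c : R) (g : {poly R}) :
  c != 0 -> rdivides g c%:P -> g = (g`_0)%:P.
Proof.
move=> c0 [h hE]; apply: size1_polyC.
have [h0 g0] : h != 0 /\ g != 0.
  have : c%:P != 0 by rewrite polyC_eq0.
  by rewrite hE mulf_eq0 => /norP.
have : size (h * g) = 1%N by rewrite -hE size_polyC c0.
rewrite size_mul //; move: h0 g0; rewrite -!size_poly_gt0.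
by move: (size h) (size g) => a b; lia.
Qed.

Lemma squarefree_polyC (R : idomainType) (p : R) :
  p != 0 -> squarefree p -> squarefree p%:P.
Proof.
move=> p0 sq G [H GH].
have GE : G = (G`_0)%:P.
  by apply: (dvd_polyC p0); exists (H * G); rewrite GH; ring.
have HE : H = (H`_0)%:P.
  by apply: (dvd_polyC p0); exists (G ^+ 2); rewrite GH mulrC.
rewrite GE rmorph_unit //; apply: sq; exists H`_0; apply: polyC_inj.
by rewrite polyCM polyC_exp -GE -HE.
Qed.

Section Shift.
Variables (R : idomainType) (n : nat).
Implicit Types (v : 'I_n -> R) (p : {mpoly R[n]}).

(* [shift v p] is p(y + T v), a polynomial in T over R[y]. *)
Definition shift v : {mpoly R[n]} -> {poly {mpoly R[n]}} :=
  mmap (polyC \o @mpolyC n R) (fun i => ('X_i)%:P + (v i)%:MP%:P * 'X).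
HB.instance Definition _ v := GRing.RMorphism.on (shift v).

(** The extension of [shift v] to R[y][T] fixing T: an automorphism, with inverse the translation
    along -v. *)
Definition shift_poly v : {poly {mpoly R[n]}} -> {poly {mpoly R[n]}} :=
  horner_eval 'X \o map_poly (shift v).
HB.instance Definition _ v := GRing.RMorphism.on (shift_poly v).

Lemma shiftC v c : shift v c%:MP = c%:MP%:P.
Proof. by rewrite [LHS]mmapC. Qed.

Lemma shiftX v i : shift v 'X_i = ('X_i)%:P + (v i)%:MP%:P * 'X.
Proof. by rewrite [LHS]mmapX mmap1U. Qed.

Lemma shift_polyC v p : shift_poly v p%:P = shift v p.
Proof. by rewrite /shift_poly /= map_polyC horner_evalE hornerC. Qed.

Lemma shift_polyX v : shift_poly v 'X = 'X.
Proof. by rewrite /shift_poly /= map_polyX horner_evalE hornerX. Qed.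

Lemma shift_polyK v w : (forall i, w i = - v i) ->
  cancel (shift_poly v) (shift_poly w).
Proof.
move=> wE; apply: (@poly_rmorph_ext _ _ (shift_poly w \o shift_poly v) idfun) => [c|] /=;
  last by rewrite !shift_polyX.
apply: (@mpoly_rmorph_ext _ _ _ (shift_poly w \o shift_poly v \o polyC) polyC) => [a|j] /=.
  by rewrite shift_polyC shiftC shift_polyC shiftC.
rewrite shift_polyC shiftX rmorphD rmorphM /= !shift_polyC shiftX shiftC shift_polyX wE /=.
by rewrite !rmorphN mulNr addrNK.
Qed.

Lemma horner0_shift v p : (shift v p).[0] = p.
Proof.
apply: (@mpoly_rmorph_ext _ _ _ (horner_eval 0 \o shift v) idfun) => [c|i] /=.
  by rewrite shiftC horner_evalE hornerC.
by rewrite shiftX horner_evalE !hornerE.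
Qed.

(** The polynomial [shift v p] is the image of the constant p under the automorphism [shift_poly v],
    and a constant stays square-free in R[y][T]. *)
Lemma squarefree_shift v p : p != 0 -> squarefree p -> squarefree (shift v p).
Proof.
move=> p0 sq G [H GH].
pose w i := - v i; have vw i : v i = - w i by rewrite opprK.
rewrite -(shift_polyK vw G) rmorph_unit //.
apply: (squarefree_polyC p0 sq); exists (shift_poly w H).
by rewrite -rmorphXn -rmorphM /= -GH -shift_polyC shift_polyK.
Qed.

(* Total degree at most k in the variables y and T. *)
Definition total_deg_le k (f : {poly {mpoly R[n]}}) : Prop :=
  forall j, (msize f`_j <= k.+1 - j)%N.

Lemma total_deg_leD k f g :
  total_deg_le k f -> total_deg_le k g -> total_deg_le k (f + g).
Proof.
move=> fk gk j; rewrite coefD (leq_trans (msizeD_le _ _)) // geq_max.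
by rewrite fk gk.
Qed.

Lemma total_deg_leM k l f g :
  total_deg_le k f -> total_deg_le l g -> total_deg_le (k + l) (f * g).
Proof.
move=> fk gl j; rewrite coefM; apply: (leq_trans (msize_sum _ _ _)).
apply/bigmax_leqP => i _; have [->|f0] := eqVneq f`_i 0.
  by rewrite mul0r msize0.
have [->|g0] := eqVneq g`_(j - i) 0; first by rewrite mulr0 msize0.
rewrite msizeM //; move: (fk i) (gl (j - i)%N) f0 g0 (ltn_ord i).
by rewrite -!msize_poly_eq0; lia.
Qed.

Lemma total_deg_le_mpolyC c : total_deg_le 0 c%:MP%:P.
Proof. by case=> [|j]; rewrite coefC /= ?msize0 // msizeC; case: eqP. Qed.

Lemma total_deg_leX k f : total_deg_le 1 f -> total_deg_le k (f ^+ k).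
Proof.
move=> f1; elim: k => [|k IHk]; last by rewrite exprS -add1n; apply: total_deg_leM.
by rewrite expr0 -[1]/(1%:P) -mpolyC1; apply: total_deg_le_mpolyC.
Qed.

Lemma total_deg_le_shiftX v i : total_deg_le 1 (shift v 'X_i).
Proof.
rewrite shiftX => -[|[|j]]; rewrite coefD coefC coefCM coefX /=.
- by rewrite mulr0 addr0 msizeX mdeg1.
- by rewrite add0r mulr1 msizeC; case: eqP.
- by rewrite mulr0 addr0 msize0.
Qed.

Lemma total_deg_le_shift v d p : p \is d.-homog -> total_deg_le d (shift v p).
Proof.
move=> /dhomogP pd; rewrite [p]mpolyE rmorph_sum /= big_seq.
elim/big_rec: _ => [j|m f mp fd]; first by rewrite coef0 msize0.
apply: total_deg_leD => //; rewrite -mul_mpolyC rmorphM /= shiftC -[d]add0n.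
apply: total_deg_leM; first exact: total_deg_le_mpolyC.
rewrite -(pd m mp) mpolyXE_id rmorph_prod /= mdegE.
elim/big_rec2: _ => [|i k g _ kg].
  by rewrite -[1]/(1%:P) -mpolyC1; apply: total_deg_le_mpolyC.
by rewrite rmorphXn; apply: total_deg_leM => //; apply/total_deg_leX/total_deg_le_shiftX.
Qed.

(** For j > d the truncated bound [d.+1 - j] is 0, which forces the coefficient of T^j to vanish. *)
Lemma size_shift_le v d p : p \is d.-homog -> (size (shift v p) <= d.+1)%N.
Proof.
move=> /(total_deg_le_shift v) pd; apply/leq_sizeP => j dj; apply/eqP.
by rewrite -msize_poly_eq0 -leqn0 -(eqP (_ : d.+1 - j == 0)%N) // subn_eq0.
Qed.

(** By the total degree bound this coefficient is a constant, so it can be read off at y = 0, where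
    homogeneity gives p(T v) = p(v) T^d. *)
Lemma coef_shift_top v d p : p \is d.-homog -> (shift v p)`_d = (p.@[v])%:MP.
Proof.
move=> pd; have pd' := total_deg_le_shift v pd d; rewrite subSnn in pd'.
rewrite [LHS]msize1_polyC //; congr _%:MP.
have -> : (shift v p)`_d@_0 = (map_poly (meval (fun=> 0)) (shift v p))`_d.
  by rewrite coef_map /= {2}[(shift v p)`_d]msize1_polyC // mevalC.
have -> : map_poly (meval (fun=> 0)) (shift v p) = p.@[v]%:P * 'X^d.
  pose ev : {mpoly R[n]} -> {poly R} :=
    mmap polyC (fun i => (v i)%:P * 'X).
  transitivity (ev p).
    apply: (@mpoly_rmorph_ext _ _ _ (map_poly (meval (fun=> 0)) \o shift v) ev) => [c|i] /=.
      by rewrite shiftC map_polyC /= mevalC [RHS]mmapC.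
    rewrite shiftX rmorphD rmorphM /= !map_polyC map_polyX /= mevalC mevalXU.
    by rewrite polyC0 add0r [RHS]mmapX mmap1U.
  rewrite /ev /mmap mevalE rmorph_sum mulr_suml /=.
  rewrite !big_seq; apply: eq_bigr => m mp.
  rewrite -(dhomog_mf pd mp : mdeg m = d) rmorphM -mulrA; congr (_ * _).
  rewrite /mmap1 rmorph_prod mdegE.
  rewrite -prodrXr -big_split /=; apply: eq_bigr => i _.
  by rewrite exprMn rmorphXn.
by rewrite coefCM coefXn eqxx mulr1.
Qed.

End Shift.

(** * Degrees of resultants and numbers of prime factors *)

Section ResultantDegree.
Variables (R : idomainType) (n : nat).

(** Each term of the Leibniz expansion is a product of m entries of degree at most k; [msize] is the
    degree plus one, and 0 for the zero polynomial. *)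
Lemma msize_det_le k m (A : 'M[{mpoly R[n]}]_m) :
  (forall i j, msize (A i j) <= k.+1)%N -> (msize (\det A) <= (m * k).+1)%N.
Proof.
move=> Ak; apply: (leq_trans (msize_sum _ _ _)); apply/bigmax_leqP => s _.
have -> : msize ((-1) ^+ s * \prod_i A i (s i)) = msize (\prod_i A i (s i)).
  by case: odd_perm; rewrite ?expr1 ?mulN1r ?msizeN // expr0 mul1r.
have -> : (m * k = \sum_(i < m) k)%N by rewrite sum_nat_const card_ord.
elim/big_rec2: _ => [|i p l _ lp]; first by rewrite msize1.
have [->|a0] := eqVneq (A i (s i)) 0; first by rewrite mul0r msize0.
have [->|p0] := eqVneq l 0; first by rewrite mulr0 msize0.
rewrite msizeM //; move: (Ak i (s i)) lp; lia.
Qed.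

Lemma msize_resultant_le k (f g : {poly {mpoly R[n]}}) :
  (forall j, msize f`_j <= k.+1)%N -> (forall j, msize g`_j <= k.+1)%N ->
  (msize (resultant f g) <= (((size g).-1 + (size f).-1) * k).+1)%N.
Proof.
move=> fk gk; apply: msize_det_le => i j; rewrite Sylvester_mxE.
by case: (split i) => l; rewrite mulrb; case: ifP; rewrite ?msize0.
Qed.

End ResultantDegree.

Lemma prime_msize_gt1 (K : fieldType) n (p : {mpoly K[n]}) : prime_elt p -> (1 < msize p)%N.
Proof.
move=> [p0 pU _]; rewrite ltnNge; apply: contraNN pU => /msize1_polyC pE.
by rewrite pE rmorph_unit // unitfE -(mpolyC_eq0 n) -pE.
Qed.

(** Degrees add, and every prime has positive degree because nonzero constants are units. *)
Lemma size_prime_factors_lt (K : fieldType) n (s : seq {mpoly K[n]}) u :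
  u != 0 -> (forall p, p \in s -> prime_elt p) ->
  (size s < msize (u * \prod_(p <- s) p))%N.
Proof.
elim: s u => [|p s IHs] u u0 sp.
  by rewrite big_nil mulr1 lt0n msize_poly_eq0.
have pp := sp p (mem_head _ _); have [p0 _ _] := pp.
rewrite big_cons mulrCA; set m := u * _.
have : (size s < msize m)%N.
  by apply: IHs => // q qs; apply: sp; rewrite in_cons qs orbT.
have [->|m0] := eqVneq m 0; first by rewrite msize0.
rewrite [msize (p * m)]msizeM //=; have := prime_msize_gt1 pp.
by move: (msize p) (msize m) (size s) => a b c; lia.
Qed.

Lemma mpoly_gen_ind n (R : comNzRingType) (T : {mpoly R[n]} -> Prop) :
  (forall c, T c%:MP) -> (forall i, T 'X_i) ->
  (forall p q, T p -> T q -> T (p + q)) -> (forall p q, T p -> T q -> T (p * q)) ->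
  forall p, T p.
Proof.
move=> TC TX TD TM p.
have T1 : T 1 by rewrite -mpolyC1.
rewrite [p]mpolyE; apply: big_rec => [|m q _]; first by rewrite -mpolyC0.
apply: TD; rewrite -mul_mpolyC; apply: (TM) => //.
rewrite mpolyXE_id; apply: big_rec => // i q' _; apply: (TM).
by elim: (m i) => [|k IHk]; rewrite ?expr0 // exprS; apply: (TM).
Qed.

(** * The subring generated by the x-variables *)

Section BaseVariables.
Variables (K : fieldType) (r s : nat).

(** Setting z = 0 gives a retraction of the inclusion of A into S. *)
Definition proj_xvars : {mpoly K[r + s]} -> {mpoly K[s]} :=
  mmap (@mpolyC s K) (fun i => if split i is inr j then 'X_j else 0).
HB.instance Definition _ := GRing.RMorphism.on proj_xvars.

HB.instance Definition _ := GRing.RMorphism.copy (@inclA K r s) (comp_mpoly (xvars K r s)).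

(* Multiplying each z-variable by a new variable, which makes the degree in z
   an ordinary degree. *)
Definition grade_zvars : {mpoly K[r + s]} -> {poly {mpoly K[r + s]}} :=
  mmap (polyC \o @mpolyC (r + s) K)
    (fun i => if split i is inr _ then ('X_i)%:P else ('X_i)%:P * 'X).
HB.instance Definition _ := GRing.RMorphism.on grade_zvars.

Lemma inclAC c : inclA r c%:MP = c%:MP :> {mpoly K[r + s]}.
Proof. by rewrite /inclA comp_mpolyC. Qed.

Lemma inclAX j : inclA r 'X_j = 'X_(rshift r j) :> {mpoly K[r + s]}.
Proof. by rewrite [LHS]mmapX mmap1U tnth_mktuple. Qed.

Lemma proj_xvarsC c : proj_xvars c%:MP = c%:MP.
Proof. by rewrite [LHS]mmapC. Qed.

Lemma proj_xvarsX i : proj_xvars 'X_i = if split i is inr j then 'X_j else 0.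
Proof. by rewrite [LHS]mmapX mmap1U. Qed.

Lemma grade_zvarsC c : grade_zvars c%:MP = c%:MP%:P.
Proof. by rewrite [LHS]mmapC. Qed.

Lemma grade_zvarsX i :
  grade_zvars 'X_i = if split i is inr _ then ('X_i)%:P else ('X_i)%:P * 'X.
Proof. by rewrite [LHS]mmapX mmap1U. Qed.

Lemma split_rshift j : split (rshift r j : 'I_(r + s)) = inr j.
Proof. exact: (unsplitK (inr j)). Qed.

Lemma inclAK : cancel (@inclA K r s) proj_xvars.
Proof.
apply: (@mpoly_rmorph_ext _ _ _ (proj_xvars \o @inclA K r s) idfun) => [c|j] /=.
  by rewrite inclAC proj_xvarsC.
by rewrite inclAX proj_xvarsX split_rshift.
Qed.

Lemma grade_zvars_inclA q : grade_zvars (inclA r q) = (inclA r q)%:P.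
Proof.
apply: (@mpoly_rmorph_ext _ _ _ (grade_zvars \o @inclA K r s) (polyC \o @inclA K r s))
  => [c|j] /=.
  by rewrite inclAC grade_zvarsC.
by rewrite inclAX grade_zvarsX split_rshift.
Qed.

Lemma horner1_grade_zvars p : (grade_zvars p).[1] = p.
Proof.
apply: (@mpoly_rmorph_ext _ _ _ (horner_eval 1 \o grade_zvars) idfun) => [c|i] /=.
  by rewrite grade_zvarsC horner_evalE hornerC.
by rewrite grade_zvarsX horner_evalE; case: split => _; rewrite !hornerE.
Qed.

Lemma horner0_grade_zvars p : (grade_zvars p).[0] = inclA r (proj_xvars p).
Proof.
apply: (@mpoly_rmorph_ext _ _ _ (horner_eval 0 \o grade_zvars)
  (@inclA K r s \o proj_xvars)) => [c|i] /=.
  by rewrite grade_zvarsC horner_evalE hornerC proj_xvarsC inclAC.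
rewrite grade_zvarsX proj_xvarsX horner_evalE; case: split_ordP => j ->.
  by rewrite !hornerE rmorph0.
by rewrite inclAX hornerC.
Qed.

(** A divisor of a nonzero polynomial of z-degree 0 has z-degree 0, so its graded form is constant
    in the new variable: the value at 1, which is g, equals the value at 0, which lies in A. *)
Lemma dvd_inclA q g : q != 0 -> rdivides g (inclA r q) -> g = inclA r (proj_xvars g).
Proof.
move=> q0 [h hE]; rewrite -horner0_grade_zvars -[LHS]horner1_grade_zvars.
have iq0 : inclA r q != 0 by rewrite -(rmorph0 (@inclA K r s)) (inj_eq (can_inj inclAK)).
have -> : grade_zvars g = ((grade_zvars g)`_0)%:P.
  apply: (dvd_polyC iq0); exists (grade_zvars h).
  by rewrite -rmorphM /= -hE grade_zvars_inclA.
by rewrite !hornerC.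
Qed.

Lemma squarefree_inclA (q : {mpoly K[s]}) : q != 0 -> squarefree q -> squarefree (inclA r q).
Proof.
move=> q0 sq g gq; have gE : g = inclA r (proj_xvars g).
  by apply: (dvd_inclA q0); apply: rdivides_trans gq; exists g.
rewrite gE rmorph_unit //; apply: sq; rewrite -rmorphXn -[q]inclAK.
exact: rdivides_rmorph.
Qed.

Lemma no_common_factor_inclA (q1 q2 : {mpoly K[s]}) : q1 != 0 ->
  no_common_factor q1 q2 -> no_common_factor (inclA r q1) (inclA r q2).
Proof.
move=> q10 ncf g g1 g2; rewrite (dvd_inclA q10 g1) rmorph_unit //.
by apply: ncf; rewrite -[X in rdivides _ X]inclAK; apply: rdivides_rmorph.
Qed.

Lemma inclA_shift v (q : {mpoly K[s]}) : (forall j, v (rshift r j) = 0) ->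
  shift v (inclA r q) = (inclA r q)%:P.
Proof.
move=> v0; apply: (@mpoly_rmorph_ext _ _ _ (shift v \o @inclA K r s) (polyC \o @inclA K r s))
  => [c|j] /=.
  by rewrite inclAC shiftC.
by rewrite inclAX shiftX v0 mpolyC0 polyC0 mul0r addr0.
Qed.

(** Reduction modulo the x-variables, with K[z] kept inside S. *)
Definition kill_xvars : {mpoly K[r + s]} -> {mpoly K[r + s]} :=
  mmap (@mpolyC (r + s) K) (fun i => if split i is inl _ then 'X_i else 0).
HB.instance Definition _ := GRing.RMorphism.on kill_xvars.

Lemma kill_xvarsX i : kill_xvars 'X_i = if split i is inl _ then 'X_i else 0.
Proof. by rewrite [LHS]mmapX mmap1U. Qed.

Lemma kill_xvarsC c : kill_xvars c%:MP = c%:MP.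
Proof. by rewrite [LHS]mmapC. Qed.

Lemma ideal_xvars_var j : ideal_gen (xvars K r s) 'X_(rshift r j).
Proof.
exists (fun k => (k == j)%:R); rewrite (bigD1 j) //= big1 => [|k /negPf ->].
  by rewrite eqxx mul1r addr0 tnth_mktuple.
by rewrite mul0r.
Qed.

Lemma ideal_gen_add (R : comUnitRingType) n (g : n.-tuple R) a b :
  ideal_gen g a -> ideal_gen g b -> ideal_gen g (a + b).
Proof.
move=> [c ->] [d ->]; exists (fun i => c i + d i).
by rewrite -big_split; apply: eq_bigr => i _; rewrite mulrDl.
Qed.

Lemma ideal_gen_mull (R : comUnitRingType) n (g : n.-tuple R) a b :
  ideal_gen g b -> ideal_gen g (a * b).
Proof.
move=> [d ->]; exists (fun i => a * d i).
by rewrite mulr_sumr; apply: eq_bigr => i _; rewrite mulrA.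
Qed.

Lemma ideal_gen0 (R : comUnitRingType) n (g : n.-tuple R) : ideal_gen g 0.
Proof. by exists (fun=> 0); rewrite big1 // => i _; rewrite mul0r. Qed.

Lemma sub_kill_xvars p : ideal_gen (xvars K r s) (p - kill_xvars p).
Proof.
elim/mpoly_gen_ind: p => [c|i|p q pJ qJ|p q pJ qJ].
- by rewrite kill_xvarsC subrr; apply: ideal_gen0.
- rewrite kill_xvarsX; case: split_ordP => j ->.
    by rewrite subrr; apply: ideal_gen0.
  by rewrite subr0; apply: ideal_xvars_var.
- by rewrite rmorphD opprD addrACA; apply: ideal_gen_add.
rewrite rmorphM /=.
have -> : p * q - kill_xvars p * kill_xvars q =
  q * (p - kill_xvars p) + kill_xvars p * (q - kill_xvars q) by ring.
by apply: ideal_gen_add; apply: ideal_gen_mull.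
Qed.

End BaseVariables.

(** Outside the ideal of the x-variables, p(z, 0) is a nonzero polynomial; a non-root of it,
    completed by zeros, is the required vector. *)
Lemma nonroot_zvars (K : closedFieldType) r s (p : {mpoly K[r + s]}) :
  ~ ideal_gen (xvars K r s) p ->
  exists v, (forall j, v (rshift r j) = 0) /\ p.@[v] != 0.
Proof.
move=> pJ; have /mpoly_nonroot[w wP] : kill_xvars p != 0.
  apply/eqP => kp; apply: pJ.
  by have := sub_kill_xvars p; rewrite kp subr0.
exists (fun i => if split i is inl _ then w i else 0); split.
  by move=> j; rewrite split_rshift.
rewrite (_ : p.@[_] = (kill_xvars p).@[w]) //.
apply: (@mpoly_rmorph_ext _ _ _ (meval _) (meval w \o @kill_xvars K r s)) => [c|i] /=.
  by rewrite kill_xvarsC !mevalC.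
by rewrite kill_xvarsX mevalXU; case: split => _; rewrite ?mevalXU ?meval0.
Qed.

(** * Counting the primes of the discriminant *)

Lemma ideal_gen2 (R : comUnitRingType) (a b f : R) :
  ideal_gen [tuple a; b] f <-> exists c d, f = c * a + d * b.
Proof.
split=> [[c ->]|[c [d ->]]].
  by exists (c ord0), (c (lift ord0 ord0)); rewrite !big_ord_recl big_ord0 addr0.
exists (fun i => if i == ord0 then c else d).
by rewrite !big_ord_recl big_ord0 addr0.
Qed.

(** Each p_i divides some member of the list and is sent to its position; two primes sent to the
    same position are associate to the same member. *)
Lemma prime_factors_injection (R : idomainType) (I : Type) (p : I -> R) u (s : seq R) :
  (forall i, prime_elt (p i)) -> u \is a GRing.unit ->
  (forall q, q \in s -> prime_elt q) ->
  (forall i, rdivides (p i) (u * \prod_(q <- s) q)) ->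
  (forall i j, i <> j -> ~ rdivides (p i) (p j)) ->
  exists f : I -> 'I_(size s), injective f.
Proof.
move=> pp uu sp ps ndvd.
have qP i : exists q, q \in s /\ rdivides (p i) q.
  have [_ _ pM] := pp i.
  case: (pM _ _ (ps i)) => [/(prime_ndvd_unit (pp i) uu)//|].
  by case/(prime_dvd_prod (pp i)) => q qs pq; exists q.
have [q {}qP] := choice _ qP.
have qs i : (index (q i) s < size s)%N by rewrite index_mem; case: (qP i).
exists (fun i => Ordinal (qs i)) => i j /(congr1 val) /= ij.
apply: NNPP => /ndvd; apply.
have qE : q i = q j by rewrite -(nth_index 0 (qP i).1) ij nth_index ?(qP j).1.
have [qis piq] := qP i; have [_ pjq] := qP j; rewrite -qE in pjq.
have [v uv vE] := prime_dvd_prime (pp j) (sp _ qis) pjq.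
move: piq; rewrite vE => piq; have [_ _ pM] := pp i.
by case: (pM _ _ piq) => // /(prime_ndvd_unit (pp i) uv).
Qed.

Section Main.
Variables (K : closedFieldType) (r s d : nat) (d_gt0 : (1 <= d)%N).
Variables (K_char0 : [pchar K] =i pred0).
Variables (P : {mpoly K[r + s]}) (v : 'I_(r + s) -> K).
Hypotheses (P_red : reduced_form d P) (v0 : forall j, v (rshift r j) = 0)
  (Pv : P.@[v] != 0).

Local Notation F := (shift v P).
Local Notation D := (resultant F F^`()).

Lemma size_shift : size F = d.+1.
Proof.
have [Phom _] := P_red.
apply/eqP; rewrite eqn_leq size_shift_le //= ltnNge; apply/negP.
move=> /leq_sizeP/(_ d (leqnn _)); rewrite (coef_shift_top _ Phom) => /eqP.
by rewrite mpolyC_eq0 (negPf Pv).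
Qed.

Lemma mpoly_char0 n : n.+1%:R != 0 :> {mpoly K[r + s]}.
Proof.
rewrite -(rmorph_nat (@mpolyC (r + s) K)) mpolyC_eq0.
by move/pcharf0P: K_char0 => ->.
Qed.

Lemma unit_lead_coef_shift : lead_coef F \is a GRing.unit.
Proof.
have [Phom _] := P_red.
by rewrite lead_coefE size_shift (coef_shift_top _ Phom) rmorph_unit // unitfE.
Qed.

(** This coefficient is d P(v), where d is positive and the characteristic is 0. *)
Lemma unit_lead_coef_deriv_shift : lead_coef F^`() \is a GRing.unit.
Proof.
rewrite (lead_coef_deriv_char0 mpoly_char0) size_shift /= -mulr_natr unitrM unit_lead_coef_shift.
rewrite -(rmorph_nat (@mpolyC (r + s) K)) rmorph_unit // unitfE.
by move/pcharf0P: K_char0 => ->; rewrite -lt0n.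
Qed.

Lemma discr_shift_neq0 : D != 0.
Proof.
have [_ Psq] := P_red.
have Fsep : separable_poly F.
  apply: (squarefree_separable (@factorial_mpoly K (r + s)) mpoly_char0 unit_lead_coef_shift).
  by apply: squarefree_shift => //; apply: squarefree_neq0.
rewrite resultant_eq0 -leqNgt.
by move: Fsep; rewrite separable_poly.unlock /coprimep => /eqP ->.
Qed.

(** The Sylvester matrix has order d + (d - 1), and its entries have degree at most d in y. *)
Lemma msize_discr_shift : (msize D <= (d * (2 * d - 1)).+1)%N.
Proof.
have [Phom _] := P_red; have Fdeg := total_deg_le_shift v Phom.
have Fd j : (msize F`_j <= d.+1)%N.
  by apply: leq_trans (Fdeg j) _; apply: leq_subr.
apply: leq_trans (msize_resultant_le Fd (k := d) _) _ => [j|].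
  rewrite coef_deriv -mulr_natr -(rmorph_nat (@mpolyC (r + s) K)).
  by rewrite mulrC mul_mpolyC (leq_trans (mmeasureZ_le _ _ _)).
rewrite (size_deriv_char0 mpoly_char0) size_shift; move: d_gt0; nia.
Qed.

Lemma common_prime_of_not_radical (q : {mpoly K[s]}) : squarefree q ->
  ~ radical_ideal (ideal_gen [tuple P; inclA r q]) ->
  exists p, [/\ prime_elt p, rdivides p (inclA r q) & rdivides p D].
Proof.
move=> sq nrad; apply: NNPP => np; apply: nrad => f k /ideal_gen2[a [b fkE]].
have sq' : squarefree (inclA r q) := squarefree_inclA (squarefree_neq0 sq) sq.
have cop p : prime_elt p -> rdivides p (inclA r q) -> ~ rdivides p D.
  by move=> pp pq pD; apply: np; exists p.
have FkE : shift v f ^+ k = shift v a * F + shift v b * (inclA r q)%:P.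
  by rewrite -rmorphXn fkE rmorphD !rmorphM /= inclA_shift.
have [a' [b' fE]] := radical_of_discriminant (@factorial_mpoly K (r + s))
  unit_lead_coef_shift unit_lead_coef_deriv_shift sq' cop FkE.
(* Setting T = 0 undoes the translation and turns membership in (F, Q) into membership in (P, Q). *)
apply/ideal_gen2; exists a'.[0], b'.[0].
by rewrite -[LHS](horner0_shift v) fE !hornerE horner0_shift.
Qed.

End Main.

Theorem corollary1p10 (K : closedFieldType) (K_char0 : [pchar K] =i pred0)
    (r s d : nat) (d_gt0 : (1 <= d)%N)
    (P : {mpoly K[r + s]}) (P_red : reduced_form d P)
    (P_notin : ~ ideal_gen (xvars K r s) P)
    (I : Type) (Q : I -> {mpoly K[s]})
    (Q_red : forall i, exists e : nat, reduced_form e (Q i))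
    (Q_nocommon : forall i j, i <> j -> no_common_factor (Q i) (Q j))
    (Q_notrad : forall i,
      ~ radical_ideal (ideal_gen [tuple P; inclA r (Q i)])) :
  exists f : I -> 'I_(d ^ 2 * (2 * d - 1))%N, injective f.
Proof.
have [v [v0 Pv]] := nonroot_zvars P_notin.
have sqQ i : squarefree (Q i) by have [e []] := Q_red i.
(* For each i a prime dividing both Q_i and the discriminant is chosen. *)
have [p pP] := choice _ (fun i =>
  common_prime_of_not_radical d_gt0 K_char0 P_red v0 Pv (sqQ i) (Q_notrad i)).
have D0 := discr_shift_neq0 K_char0 P_red Pv.
have [u [t [uu tp DE]]] := factorial_mpoly D0.
have pp i : prime_elt (p i) by have [] := pP i.
have pD i : rdivides (p i) (u * \prod_(q <- t) q) by rewrite -DE; have [] := pP i.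
(* Otherwise p_i would be a common factor of Q_i and Q_j. *)
have ndvd i j : i <> j -> ~ rdivides (p i) (p j).
  move=> ij pij; have [[_ /negP pU _] piQ _] := pP i; have [_ pjQ _] := pP j.
  apply/pU/(no_common_factor_inclA (squarefree_neq0 (sqQ i)) (Q_nocommon i j ij) piQ).
  exact: rdivides_trans pij pjQ.
have [f finj] := prime_factors_injection pp uu tp pD ndvd.
have le_t : (size t <= d ^ 2 * (2 * d - 1))%N.
  have u0 : u != 0 by apply: contraTneq uu => ->; rewrite unitr0.
  (* The degree of the discriminant bounds the count by d(2d-1), which is at most d^2(2d-1) as d is
     positive. *)
  apply: (@leq_trans (d * (2 * d - 1))); last by rewrite leq_mul2r leq_pmulr ?orbT.
  rewrite -ltnS (leq_trans _ (msize_discr_shift d_gt0 K_char0 P_red Pv)) // DE.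
  exact: size_prime_factors_lt.
exists (fun i => widen_ord le_t (f i)) => i j /(congr1 val) /= ij.
by apply/finj/val_inj.
Qed.
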